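(* Let $G$ be a deterministic mean-payoff game (DMPG) with rewards in $\{0,1,\dots,M\}$ and largest reward $M\ge1$, let $s$ be a state of $G$ and let $\lambda$ be a rational number. Let $G'=\mathsf{Red}(G)$ be the associated turn-based stochastic game with boolean rewards. Then $\mathrm{val}(s)\ge\lambda$ in $G$ if and only if (the state corresponding to) $s$ belongs to $$\mathsf{Almost}_1\!\left(\mathsf{LimInfAvg}\!\left(\tfrac{\lambda}{3M}\right)\right)=\mathsf{Positive}_1\!\left(\mathsf{LimInfAvg}\!\left(\tfrac{\lambda}{3M}\right)\right)$$ in $G'$; in particular these two sets are equal in $G'$.
   Context: A turn-based stochastic game $((S,E),(S_1,S_2,S_P),\delta)$ consists of a finite directed graph $(S,E)$ in which every state has an outgoing edge, a partition of $S$ into player-1 states $S_1$, player-2 states $S_2$ and probabilistic states $S_P$, and $\delta:S_P\to\mathcal D(S)$ (probability distributions on $S$) with $(s,t)\in E$ iff $\delta(s)(t)>0$ for $s\in S_P$. In player-$i$ states player $i$ chooses the successor along an edge; in probabilistic states it is drawn from $\delta$. Strategies may be randomized and history-dependent. Rewards are on edges, and $\mathsf{LimInfAvg}(\lambda)$ is the set of plays whose edge-reward sequence $r_0,r_1,\dots$ satisfies $\liminf_N\frac1N\sum_{i<N}r_i\ge\lambda$. $\mathsf{Almost}_1(\Phi)=\{s\mid\exists\sigma_1\forall\sigma_2:\Pr_s^{\sigma_1,\sigma_2}(\Phi)=1\}$ and $\mathsf{Positive}_1(\Phi)=\{s\mid\exists\sigma_1\forall\sigma_2:\Pr_s^{\sigma_1,\sigma_2}(\Phi)>0\}$.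 A DMPG is a turn-based game $G=((S,E),(S_1,S_2))$ with no probabilistic states and a reward function $r:E\to\{0,1,\dots,M\}$. For positional (pure, memoryless) strategies $\sigma_1,\sigma_2$ and a start state $s$, a unique cycle $C$ is repeated forever and $\mathrm{val}(s,\sigma_1,\sigma_2)=\frac{1}{|C|}\sum_{e\in C}r(e)$; $\mathrm{val}(s)=\max_{\sigma_1}\min_{\sigma_2}\mathrm{val}(s,\sigma_1,\sigma_2)$ over positional strategies. Reduction $G'=\mathsf{Red}(G)$: the player-1 and player-2 states of $G'$ are $S_1$ and $S_2$. Each edge $e=(s,t)$ of $G$ is replaced by four probabilistic states $v^1(e),\dots,v^4(e)$ and: an edge $s\to v^1(e)$ with reward 0; from $v^1(e)$ the next state is $v^2(e)$ with probability $\frac{r(e)}{M}$ and $v^3(e)$ with probability $\frac{M-r(e)}{M}$, with reward 0; from each of $v^2(e)$, $v^3(e)$ the next state is $v^4(e)$ with probability $1-\frac1M$ and $t$ with probability $\frac1M$, with reward 1 on the edges leaving $v^2(e)$ and reward 0 on the edges leaving $v^3(e)$; from $v^4(e)$ the next state is $v^1(e)$ with probability 1 and reward 0. (Transitions of probability 0 are absent.) *)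

(* Defs.v *)
From HB Require Import structures.
From mathcomp Require Import all_boot all_order all_algebra.
From mathcomp Require Import all_classical all_reals all_analysis.
From mathcomp Require Import measurable_realfun.

Set Implicit Arguments.
Unset Strict Implicit.
Unset Printing Implicit Defensive.
Import Order.TTheory GRing.Theory Num.Theory.
Import numFieldNormedType.Exports.

Local Open Scope classical_set_scope.
Local Open Scope ring_scope.

Record fdist (R : realType) (T : finType) := FDist {
  fdist_fun :> T -> R;
  fdist_ge0 : forall t, 0 <= fdist_fun t;
  fdist_sum1 : \sum_t fdist_fun t = 1 }.

(** [seqs x0] is the type of infinite sequences over [T]. The argument [x0] only
    provides the default point that measurable types require. *)
Definition seqs (T : finType) (x0 : T) : Type := nat -> T.
HB.instance Definition _ (T : finType) (x0 : T) :=
  Choice.copy (seqs x0) (nat -> T).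
HB.instance Definition _ (T : finType) (x0 : T) :=
  isPointed.Build (seqs x0) (fun _ => x0).

Definition cylinder (T : Type) (p : seq T) : set (nat -> T) :=
  [set w | mkseq w (size p) = p].

Definition seqs_mtype (T : finType) (x0 : T) :=
  g_sigma_algebraType (range (@cylinder T : seq T -> set (seqs x0))).

Section tree_measure.
Context (R : realType) (T : finType) (x0 : T) (m : seq T -> R).
Hypothesis m_ge0 : forall p, 0 <= m p.
Hypothesis m_nil : m [::] = 1.
Hypothesis m_rcons : forall p, m p = \sum_t m (rcons p t).

(* Push the uniform law on [0, 1[ forward: each prefix p gets the interval
   [lo p, lo p + m p[, cut into consecutive intervals for its extensions. *)
Let before (p : seq T) (t : T) : R :=
  \sum_(t' | (enum_rank t' < enum_rank t)%N) m (rcons p t').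

Let lo (p : seq T) : R :=
  \sum_(i < size p) before (take i p) (nth x0 p i).

Let inI (u : R) (p : seq T) : bool := (lo p <= u) && (u < lo p + m p).

Let lo_rcons p t : lo (rcons p t) = lo p + before p t.
Proof.
rewrite /lo size_rcons big_ord_recr /=; congr (_ + _).
  apply: eq_bigr => i _.
  by rewrite -cats1 take_cat ltn_ord nth_cat ltn_ord.
by rewrite -cats1 take_size_cat// nth_cat ltnn subnn.
Qed.

Let before_next p t : before p t + m (rcons p t) =
  \sum_(t' | (enum_rank t' <= enum_rank t)%N) m (rcons p t').
Proof.
rewrite [RHS](bigD1 t)//= addrC; congr (_ + _); apply: eq_bigl => t'.
by rewrite ltn_neqAle andbC; congr (_ && ~~ _); apply/eqP/eqP => [/val_inj/enum_rank_inj|->].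
Qed.

Let inI_sub u p t : inI u (rcons p t) -> inI u p.
Proof.
rewrite /inI lo_rcons => /andP[h1 h2]; apply/andP; split.
  by apply: le_trans h1; rewrite lerDl; apply: sumr_ge0.
apply: (lt_le_trans h2); rewrite -addrA before_next lerD2l (m_rcons p).
by rewrite [leRHS](bigID (fun t' => (enum_rank t' <= enum_rank t)%N))/= lerDl sumr_ge0.
Qed.

Let inI_uniq u p t t' : inI u (rcons p t) -> inI u (rcons p t') -> t = t'.
Proof.
have H a b : (enum_rank a < enum_rank b)%N ->
    inI u (rcons p a) -> inI u (rcons p b) -> False.
  rewrite /inI !lo_rcons => ab /andP[_ h1] /andP[h2 _].
  move: (le_lt_trans h2 h1); rewrite -addrA ltrD2l before_next ltNge => /negP; apply.
  rewrite /before [leRHS](bigID (fun t' => (enum_rank t' <= enum_rank a)%N))/=.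
  rewrite -[leLHS]addr0 lerD ?sumr_ge0//.
  rewrite le_eqVlt; apply/orP; left; apply/eqP; apply: eq_bigl => c.
  have [h|h] := leqP (enum_rank c) (enum_rank a); rewrite ?andbF ?andbT //.
  by rewrite (leq_ltn_trans h ab).
move=> h1 h2; case: (ltngtP (enum_rank t) (enum_rank t')) => h.
- by case: (H _ _ h h1 h2).
- by case: (H _ _ h h2 h1).
- by apply: enum_rank_inj; apply: val_inj.
Qed.

Let inI_ex u p : inI u p -> exists t, inI u (rcons p t).
Proof.
move=> /andP[h1 h2].
pose P t := u < lo p + (before p t + m (rcons p t)).
have [t0 Pt0] : exists t, P t.
  have n0 : (0 < #|T|)%N by apply/card_gt0P; exists x0.
  have hl : (#|T|.-1 < #|T|)%N by rewrite ltn_predL.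
  exists (enum_val (Ordinal hl)); rewrite /P before_next enum_valK/=.
  apply: (lt_le_trans h2); rewrite lerD2l (m_rcons p) le_eqVlt.
  apply/orP; left; apply/eqP; apply: eq_bigl => c.
  by rewrite -ltnS prednK// ltn_ord.
have Pt0b : P t0 by exact: Pt0.
case: (arg_minnP (fun t => enum_rank t : nat) Pt0b) => t; rewrite /P => Pt tmin.
exists t; rewrite /inI lo_rcons -addrA Pt andbT leNgt; apply/negP => ub.
have [t1 [t1t Pt1]] : exists t1, (enum_rank t1 < enum_rank t)%N /\ P t1.
  have [r0|r0] := posnP (enum_rank t : nat).
    move: ub; rewrite /before big_pred0; last by move=> c; rewrite r0 ltn0.
    by rewrite addr0 ltNge h1.
  have hl : ((enum_rank t).-1 < #|T|)%N.
    by apply: leq_ltn_trans (ltn_ord (enum_rank t)); rewrite leq_pred.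
  exists (enum_val (Ordinal hl)); split; first by rewrite enum_valK/= ltn_predL.
  rewrite /P before_next enum_valK/=.
  suff -> : \sum_(t' | (enum_rank t' <= (enum_rank t).-1)%N) m (rcons p t') = before p t by [].
  by apply: eq_bigl => c; rewrite -ltnS prednK.
by have := tmin _ Pt1; rewrite leqNgt t1t.
Qed.

Let inI_nil u : inI u [::] = (0 <= u < 1).
Proof. by rewrite /inI /lo big_ord0 m_nil add0r. Qed.

Let inI01 u p : inI u p -> 0 <= u < 1.
Proof.
by elim/last_ind: p => [|p t IH]; [rewrite inI_nil|move=> /inI_sub].
Qed.

Let ch u p : T := odflt x0 [pick t | inI u (rcons p t)].

Let ch_in u p t : inI u p -> (ch u p == t) = inI u (rcons p t).
Proof.
move=> up; rewrite /ch; case: pickP => [t' h|h]/=.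
  by apply/eqP/idP => [<-//|h']; exact: inI_uniq h h'.
by have [t' h'] := inI_ex up; rewrite h in h'.
Qed.

Let ch_out (u : R) p : ~~ (0 <= u < 1) -> ch u p = x0.
Proof.
by move=> h; rewrite /ch; case: pickP => [t' /inI01|]//; rewrite (negbTE h).
Qed.

Let pre u := fix pre n := if n is n'.+1 then rcons (pre n') (ch u (pre n')) else [::].

Let W u : seqs x0 := fun n => ch u (pre u n).

Let mkseq_W u n : mkseq (W u) n = pre u n.
Proof. by elim: n => [//|n IH]; rewrite mkseqS IH. Qed.

Let W_in (u : R) p : 0 <= u < 1 -> (pre u (size p) == p) = inI u p.
Proof.
move=> u01; elim/last_ind: p => [|p t IH]; first by rewrite inI_nil eqxx.
rewrite size_rcons /= eqseq_rcons IH; apply/andP/idP => [[h]|h].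
  have -> : pre u (size p) = p by apply/eqP; rewrite IH.
  by rewrite ch_in.
have h' := inI_sub h; split => //.
have -> : pre u (size p) = p by apply/eqP; rewrite IH.
by rewrite ch_in.
Qed.

Let W_out (u : R) n : ~~ (0 <= u < 1) -> pre u n = nseq n x0.
Proof.
move=> h; elim: n => [//|n IH] /=.
rewrite ch_out// IH; elim: n {IH} => [//|n IH]/=; by rewrite IH.
Qed.

Let cyl_in p : W @^-1` cylinder p `&` `[0, 1[%classic = `[lo p, lo p + m p[%classic.
Proof.
apply/seteqP; split => u /=.
  by rewrite /cylinder /= mkseq_W !in_itv/= => -[/eqP h u01]; rewrite W_in in h.
rewrite !in_itv /= => h; have u01 := inI01 h; split => //.
by rewrite /cylinder /= mkseq_W; apply/eqP; rewrite W_in.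
Qed.

Let cyl_out p :
  W @^-1` cylinder p `&` ~` `[0, 1[%classic =
  if nseq (size p) x0 == p then ~` `[0, 1[%classic else set0.
Proof.
apply/seteqP; split => u /=.
  rewrite in_itv/= /cylinder/= mkseq_W => -[h /negP u01]; rewrite W_out// in h.
  by rewrite h eqxx /= in_itv; exact/negP.
case: eqP => // h; rewrite /= in_itv /= => u01; split => //.
by rewrite /cylinder/= mkseq_W (W_out _ (introN idP u01)).
Qed.

Let mW : measurable_fun setT (W : measurableTypeR R -> seqs_mtype x0).
Proof.
apply: (@measurability _ _ _ (seqs_mtype x0) _ _
  (range (@cylinder T : seq T -> set (seqs x0)))) => //.
move=> _ [_ [p _ <-] <-]; rewrite setTI.
have -> : W @^-1` cylinder p = (W @^-1` cylinder p `&` `[0, 1[%classic)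
     `|` (W @^-1` cylinder p `&` ~` `[0, 1[%classic).
  by rewrite -setIUr setUv setIT.
apply: measurableU.
  by rewrite cyl_in; exact: measurable_itv.
rewrite cyl_out; case: ifP => // _; apply: measurableC; exact: measurable_itv.
Qed.

Lemma tree_measure_exists : exists P : probability (seqs_mtype x0) R,
  forall p, P (cylinder p) = (m p)%:E.
Proof.
pose U := uniform_prob (@ltr01 R).
pose X : {mfun measurableTypeR R >-> seqs_mtype x0} :=
  HB.pack (W : measurableTypeR R -> seqs_mtype x0)
    (isMeasurableFun.Build _ _ _ _ _ mW).
exists (distribution U X) => p.
have Iin : `[lo p, lo p + m p[%classic `<=` `[0 : R, 1[%classic.
  by move=> u /=; rewrite !in_itv /=; exact: inI01.
have mI : measurable (W @^-1` cylinder p : set (measurableTypeR R)).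
  rewrite -[X in measurable X]setTI; apply: mW => //.
  by apply: sub_sigma_algebra; exists p.
have mC : measurable (`[lo p, lo p + m p[%classic : set (measurableTypeR R)).
  exact: measurable_itv.
transitivity (\int[lebesgue_measure]_(u in W @^-1` cylinder p)
  (uniform_pdf 0 1 u)%:E)%E; first by [].
rewrite integral_uniform_pdf.
rewrite (eq_integral (fun=> 1%E)); last first.
  move=> u; rewrite inE => -[_ /=]; rewrite in_itv/= => u01.
  by rewrite /uniform_pdf u01 subr0 invr1.
rewrite integral_cst//=; last exact: measurableI.
rewrite mul1e -(@setUitv1 _ _ (BLeft 0) 1 true) ?bnd_simp// setIUr cyl_in.
rewrite measureU0//=; last 2 first.
- exact: measurableI.
- apply/eqP; rewrite eq_le measure_ge0 andbT -(lebesgue_measure_set1 (1 : R)).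
  by apply: le_measure; rewrite ?inE//; exact: measurableI.
rewrite lebesgue_measure_itv/= lte_fin ltrDl.
case: ltgtP (m_ge0 p) => // [mp _|<- _]; last by [].
by rewrite -EFinD addrAC subrr add0r.
Qed.

End tree_measure.

Lemma tree_measure_unique (R : realType) (T : finType) (x0 : T) (m : seq T -> R)
    (P Q : probability (seqs_mtype x0) R) :
  (forall p, P (cylinder p) = (m p)%:E) ->
  (forall p, Q (cylinder p) = (m p)%:E) ->
  forall A, measurable A -> P A = Q A.
Proof.
move=> hP hQ A mA.
pose C : set (set (seqs_mtype x0)) :=
  [set B | B = set0 \/ exists p, B = cylinder p].
have mC : C `<=` measurable.
  by move=> B [->|[p ->]]//; apply: sub_sigma_algebra; exists p.
have cylT : cylinder [::] = [set: seqs_mtype x0].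
  by apply/seteqP; split.
have cylS (p q : seq T) : (size p <= size q)%N ->
    C (cylinder p `&` cylinder q).
  move=> pq; have [e|e] := eqVneq (take (size p) q) p.
    right; exists q; apply/seteqP; split => [w []//|w wq]; split => //.
    rewrite /cylinder/= -[RHS]e -wq; apply: (@eq_from_nth _ (w 0%N)).
      by rewrite size_take_min !size_mkseq; apply/esym/minn_idPl.
    move=> i; rewrite size_mkseq => ip.
    by rewrite nth_take// !nth_mkseq// (leq_trans ip).
  left; apply/seteqP; split => // w [wp wq]; move/eqP: e; apply.
  rewrite -{1}wq -[RHS]wp; apply: (@eq_from_nth _ (w 0%N)).
    by rewrite size_take_min !size_mkseq; apply/minn_idPl.
  move=> i; rewrite size_take_min !size_mkseq (minn_idPl pq) => ip.
  by rewrite nth_take// !nth_mkseq// (leq_trans ip).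
have CI : setI_closed C.
  move=> B D [->|[p ->]] [->|[q ->]]; rewrite ?set0I ?setI0; try by left.
  have [pq|/ltnW qp] := leqP (size p) (size q); first exact: cylS.
  by rewrite setIC; exact: cylS.
apply: (@measure_unique _ R _ C (fun=> setT)) => //.
- rewrite /measurable/=; apply/seteqP; split.
    apply: sub_smallest2r; first exact: smallest_sigma_algebra.
    by move=> _ [p _ <-]; right; exists p.
  apply: smallest_sub; first exact: smallest_sigma_algebra.
  exact: mC.
- by move=> _; right; exists [::].
- by rewrite bigcup_const.
- move=> B [->|[p ->]]; first by rewrite !measure0.
  exact: etrans (hP p) (esym (hQ p)).
- by move=> _; apply: (le_lt_trans (probability_le1 P measurableT)); rewrite ltry.
Qed.

Inductive player := Player1 | Player2.

Definition player_eqb (i j : player) :=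
  match i, j with
  | Player1, Player1 | Player2, Player2 => true
  | _, _ => false
  end.
Lemma player_eqP : Equality.axiom player_eqb.
Proof. by case; case; constructor. Qed.
HB.instance Definition _ := hasDecEq.Build player player_eqP.

(** [owner] encodes the partition of the states: [Some i] for the states of
    player [i], [None] for the probabilistic ones. The value of [delta] matters
    only at probabilistic states. *)
Record tbsg (R : realType) := TBSG {
  state :> finType;
  edge : rel state;
  edge_total : forall s, exists t, edge s t;
  owner : state -> option player;
  delta : state -> fdist R state;
  edge_delta : forall s t, owner s = None -> edge s t = (0 < delta s t) }.

Arguments edge {R} _ _ _.
Arguments owner {R} _ _.
Arguments delta {R} _ _.

Section plays.
Context (R : realType) (G : tbsg R).

(** [move h s] is the choice at state [s] when [h] is the (chronological)
    sequence of the states visited before; it matters only when [i] owns [s]. *)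
Record strategy (i : player) := Strategy {
  move :> seq G -> G -> fdist R G;
  move_edge : forall h s t, owner G s = Some i -> 0 < move h s t -> edge G s t }.

Definition step (sigma1 : strategy Player1) (sigma2 : strategy Player2)
    (h : seq G) (s : G) : fdist R G :=
  match owner G s with
  | Some Player1 => sigma1 h s
  | Some Player2 => sigma2 h s
  | None => delta G s
  end.

(** Probability of visiting next the successive states of [p], when the past is
    [h] and the current state is [s]. *)
Fixpoint path_prob sigma1 sigma2 (h : seq G) (s : G) (p : seq G) : R :=
  if p is t :: q
  then step sigma1 sigma2 h s t * path_prob sigma1 sigma2 (rcons h s) t q
  else 1.

Definition prefix_prob (s : G) sigma1 sigma2 (p : seq G) : R :=
  if p is t :: q then (t == s)%:R * path_prob sigma1 sigma2 [::] t q else 1.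

Lemma path_prob_ge0 sigma1 sigma2 h s p : 0 <= path_prob sigma1 sigma2 h s p.
Proof.
by elim: p h s => [|t q IH] h s //=; rewrite mulr_ge0// fdist_ge0.
Qed.

Lemma path_prob_rcons sigma1 sigma2 h s p :
  path_prob sigma1 sigma2 h s p =
  \sum_t path_prob sigma1 sigma2 h s (rcons p t).
Proof.
elim: p h s => [|t q IH] h s /=.
  by rewrite -[LHS](fdist_sum1 (step sigma1 sigma2 h s)); apply: eq_bigr => t _;
     rewrite mulr1.
by rewrite IH mulr_sumr.
Qed.

Lemma prefix_prob_ge0 s sigma1 sigma2 p : 0 <= prefix_prob s sigma1 sigma2 p.
Proof. by case: p => [|t q] //=; rewrite mulr_ge0// path_prob_ge0. Qed.

Lemma prefix_prob_rcons s sigma1 sigma2 p :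
  prefix_prob s sigma1 sigma2 p =
  \sum_t prefix_prob s sigma1 sigma2 (rcons p t).
Proof.
case: p => [|t q] /=; last by rewrite path_prob_rcons mulr_sumr.
rewrite (bigD1 s)//= eqxx mulr1 big1 ?addr0// => t /negbTE ->.
by rewrite mul0r.
Qed.

(** The law of the play from [s]: the measure on sequences of states, unique
    on measurable sets, with cylinder probabilities [prefix_prob]. *)
Definition Pr (s : G) (sigma1 : strategy Player1) (sigma2 : strategy Player2) :
    probability (seqs_mtype s) R :=
  sval (cid (tree_measure_exists s (prefix_prob_ge0 s sigma1 sigma2) erefl
    (prefix_prob_rcons s sigma1 sigma2))).

Lemma Pr_cylinder s sigma1 sigma2 p :
  Pr s sigma1 sigma2 (cylinder p) = (prefix_prob s sigma1 sigma2 p)%:E.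
Proof. by rewrite /Pr; case: cid. Qed.

Lemma Pr_unique s sigma1 sigma2 (P : probability (seqs_mtype s) R) :
  (forall p, P (cylinder p) = (prefix_prob s sigma1 sigma2 p)%:E) ->
  forall A, measurable A -> P A = Pr s sigma1 sigma2 A.
Proof. by move=> hP; apply: tree_measure_unique hP (Pr_cylinder s _ _). Qed.

Definition is_play (w : nat -> G) : Prop := forall n, edge G (w n) (w n.+1).

(** Only the values of the reward function [r] on edges matter. *)
Definition LimInfAvg (r : G -> G -> nat) (lambda : R) : set (nat -> G) :=
  [set w | is_play w /\
    (lambda%:E <= limn_einf (fun N =>
       ((\sum_(i < N) r (w i) (w i.+1))%N%:R / N%:R)%:E))%E].

Definition Almost1 (Phi : set (nat -> G)) : set G :=
  [set s | exists sigma1, forall sigma2, Pr s sigma1 sigma2 Phi = 1%E].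

Definition Positive1 (Phi : set (nat -> G)) : set G :=
  [set s | exists sigma1, forall sigma2, (0 < Pr s sigma1 sigma2 Phi)%E].

Let measurable_mkseq (s : G) n (P : set (seq G)) :
  measurable ([set w | P (mkseq w n)] : set (seqs_mtype s)).
Proof.
have -> : [set w | P (mkseq w n)] =
    \bigcup_(p in [set p | P p /\ size p = n]) cylinder p.
  apply/seteqP; split => w.
    move=> Pw; exists (mkseq w n); first by split; rewrite // size_mkseq.
    by rewrite /cylinder/= size_mkseq.
  by move=> [p [Pp <-]]; rewrite /cylinder/= => ->.
rewrite bigcup_mkcond; apply: countable_bigcupT_measurable => [|p].
  exact: countableP.
by case: ifP => // _; apply: sub_sigma_algebra; exists p.
Qed.

Lemma measurable_LimInfAvg (s : G) r lambda :
  measurable (LimInfAvg r lambda : set (seqs_mtype s)).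
Proof.
have mplay : measurable ([set w | is_play w] : set (seqs_mtype s)).
  have -> : [set w | is_play w] =
      \bigcap_n [set w | edge G (nth s (mkseq w n.+2) n) (nth s (mkseq w n.+2) n.+1)].
    have E n w : (nth s (mkseq w n.+2) n = w n) /\
        (nth s (mkseq w n.+2) n.+1 = w n.+1).
      by rewrite !nth_mkseq.
    apply/seteqP; split => w h n.
      by move=> _; rewrite /mkset (E n w).1 (E n w).2; exact: h.
    by move: (h n Logic.I); rewrite /mkset (E n w).1 (E n w).2; exact: id.
  apply: bigcapT_measurable => n.
  exact: (@measurable_mkseq s n.+2 (fun p => edge G (nth s p n) (nth s p n.+1))).
pose f N (w : seqs_mtype s) : \bar R :=
  ((\sum_(i < N) r (w i) (w i.+1))%N%:R / N%:R)%:E.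
have mf N : measurable_fun [set: seqs_mtype s] (f N).
  move=> _ Y _; rewrite setTI.
  have E w : (\sum_(i < N) r (nth s (mkseq w N.+1) i)
      (nth s (mkseq w N.+1) i.+1) = \sum_(i < N) r (w i) (w i.+1))%N.
    apply: eq_bigr => i _; rewrite nth_mkseq ?nth_mkseq ?ltnS//.
    exact: ltnW (ltn_ord i).
  have -> : f N @^-1` Y = [set w | Y (((\sum_(i < N) r (nth s (mkseq w N.+1) i)
      (nth s (mkseq w N.+1) i.+1))%N%:R / N%:R)%:E)].
    by apply/seteqP; split => w; rewrite /mkset E.
  exact: (@measurable_mkseq s N.+1 (fun p => Y (((\sum_(i < N) r (nth s p i)
      (nth s p i.+1))%N%:R / N%:R)%:E))).
have mg : measurable_fun [set: seqs_mtype s] (fun w : seqs_mtype s => limn_einf (f ^~ w)).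
  rewrite /limn_einf; apply: measurableT_comp => //.
  apply: measurable_fun_limn_esup => N; exact: measurableT_comp.
have mge : measurable ([set w | (lambda%:E <= limn_einf (f ^~ w))%E] :
    set (seqs_mtype s)).
  have -> : [set w | (lambda%:E <= limn_einf (f ^~ w))%E] =
      (fun w => limn_einf (f ^~ w)) @^-1` `[lambda%:E, +oo%E]%classic.
    by apply/seteqP; split => w /=; rewrite in_itv/= leey andbT.
  by rewrite -[X in measurable X]setTI; apply: mg => //; exact: emeasurable_itv.
exact: measurableI mplay mge.
Qed.

End plays.

Arguments LimInfAvg {R} G r lambda.
Arguments Almost1 {R} G Phi.
Arguments Positive1 {R} G Phi.

Record dmpg (M : nat) := DMPG {
  dstate :> finType;
  dedge : rel dstate;
  dedge_total : forall s, exists t, dedge s t;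
  downer : dstate -> player;
  dreward : dstate -> dstate -> nat;
  dreward_le : forall s t, dedge s t -> (dreward s t <= M)%N }.

Arguments dedge {M} _ _ _.
Arguments downer {M} _ _.
Arguments dreward {M} _ _ _.

Section mean_payoff.
Context (M : nat) (G : dmpg M).

(** Positional strategies of player [i]; the value at a state that [i] does not
    own is irrelevant. *)
Definition positional (i : player) : Type :=
  {f : {ffun G -> G} | [forall s, (downer G s == i) ==> dedge G s (f s)]}.
HB.instance Definition _ i := Finite.on (positional i).

Definition successor (sigma1 : positional Player1) (sigma2 : positional Player2)
    (s : G) : G :=
  match downer G s with
  | Player1 => val sigma1 s
  | Player2 => val sigma2 s
  end.

(** The states of the cycle eventually reached by iterating [f] from [s]: those
    reachable from [s] that [f] comes back to. *)
Definition cycle_from (f : G -> G) (s : G) : {set G} :=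
  [set t | fconnect f s t && fconnect f (f t) t].

(** An edge of the cycle is [(t, f t)] for a unique state [t] of the cycle. *)
Definition play_value (s : G) (sigma1 : positional Player1)
    (sigma2 : positional Player2) : rat :=
  let f := successor sigma1 sigma2 in
  let C := cycle_from f s in
  (\sum_(t in C) dreward G t (f t))%N%:R / #|C|%:R.

(** Both players have positional strategies and [play_value] lies between 0 and
    [M], so the default values 0 and [M] do not affect the max and the min. *)
Definition game_value (s : G) : rat :=
  \big[Num.max/0]_(sigma1 : positional Player1)
    \big[Num.min/M%:R]_(sigma2 : positional Player2)
      play_value s sigma1 sigma2.

Definition edges : Type := {e : G * G | dedge G e.1 e.2}.
HB.instance Definition _ := Finite.on edges.
Definition src (e : edges) : G := (val e).1.
Definition tgt (e : edges) : G := (val e).2.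
Definition erew (e : edges) : nat := dreward G (src e) (tgt e).

End mean_payoff.

Inductive gadget := V1 | V2 | V3 | V4.

Definition gadget_code (v : gadget) : 'I_4 :=
  match v with V1 => inord 0 | V2 => inord 1 | V3 => inord 2 | V4 => inord 3 end.
Definition gadget_decode (k : 'I_4) : gadget :=
  match nat_of_ord k with 0 => V1 | 1 => V2 | 2 => V3 | _ => V4 end.
Lemma gadget_codeK : cancel gadget_code gadget_decode.
Proof. by case; rewrite /gadget_decode inordK. Qed.
HB.instance Definition _ := Finite.copy gadget (can_type gadget_codeK).

Section reduction.
Context (R : realType) (M : nat) (G : dmpg M).

(** [inl s] is the state [s] of [G]; [inr (e, Vi)] is the state v^i(e). *)
Definition red_state : finType := (G + edges G * gadget)%type.

Definition red_owner (x : red_state) : option player :=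
  match x with inl s => Some (downer G s) | inr _ => None end.

Definition red_prob (x y : red_state) : R :=
  match x with
  | inl s => (y == inl s)%:R
  | inr (e, V1) =>
      (erew e)%:R / M%:R * (y == inr (e, V2))%:R +
      (M - erew e)%N%:R / M%:R * (y == inr (e, V3))%:R
  | inr (e, V2) | inr (e, V3) =>
      (1 - M%:R^-1) * (y == inr (e, V4))%:R + M%:R^-1 * (y == inl (tgt e))%:R
  | inr (e, V4) => (y == inr (e, V1))%:R
  end.

Definition red_edge : rel red_state := fun x y =>
  match x, y with
  | inl s, inr (e, V1) => src e == s
  | inl _, _ => false
  | inr _, _ => 0 < red_prob x y
  end.

Definition red_reward (x y : red_state) : bool :=
  if x is inr (_, V2) then true else false.

Hypothesis M_gt0 : (0 < M)%N.

Lemma erew_le (e : edges G) : (erew e <= M)%N.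
Proof. exact: dreward_le (valP e). Qed.

Lemma red_prob_ge0 x y : 0 <= red_prob x y.
Proof.
have M1 : (M%:R^-1 : R) <= 1 by rewrite invf_le1 ?ler1n// ltr0n.
by case: x => [s|[e []]] //=; rewrite addr_ge0// mulr_ge0// ?divr_ge0// ?subr_ge0 ?invr_ge0.
Qed.

Let sum_mass (a : R) (z : red_state) : \sum_y a * (y == z)%:R = a.
Proof.
rewrite (bigD1 z)//= eqxx mulr1 big1 ?addr0// => y /negbTE ->.
by rewrite mulr0.
Qed.

Let sum_mass1 (z : red_state) : \sum_y (y == z)%:R = 1 :> R.
Proof. by rewrite -[RHS](sum_mass 1 z); apply: eq_bigr => y _; rewrite mul1r. Qed.

Lemma red_prob_sum1 x : \sum_y red_prob x y = 1.
Proof.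
have M0 : (M%:R : R) != 0 by rewrite pnatr_eq0 -lt0n.
case: x => [s|[e []]] /=; rewrite ?sum_mass1// big_split/= !sum_mass.
- by rewrite -mulrDl -natrD subnKC ?erew_le// divff.
- by rewrite subrK.
- by rewrite subrK.
Qed.

Definition red_delta (x : red_state) : fdist R red_state :=
  FDist (red_prob_ge0 x) (red_prob_sum1 x).

Lemma red_edge_total x : exists y, red_edge x y.
Proof.
case: x => [s|[e v]].
  by have [t st] := dedge_total s; exists (inr (exist _ (s, t) st, V1)); rewrite /= /src.
apply: contrapT => /forallNP h.
have : (0 : R) < \sum_y red_prob (inr (e, v)) y by rewrite red_prob_sum1.
rewrite big1 ?ltxx// => y _; apply/eqP; rewrite eq_le red_prob_ge0 andbT leNgt.
exact/negP/h.
Qed.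

Lemma red_edge_delta x y : red_owner x = None -> red_edge x y = (0 < red_delta x y).
Proof. by case: x. Qed.

Definition Red : tbsg R := TBSG red_edge_total red_edge_delta.

End reduction.

Arguments red_reward {M} G x y.

(* Main.v *)
Require Import Defs.
From mathcomp Require Import all_boot all_order all_algebra.
From mathcomp Require Import all_classical all_reals all_analysis.
From mathcomp Require Import lra ring.
Import Order.TTheory GRing.Theory Num.Theory.
Local Open Scope ring_scope.

(** In [G], near-fixpoints [v] of the discounted optimality operator with
    discount factor [1 - 1/N] come with optimal positional strategies, and
    summing the optimality inequalities around the final cycle of a play shows
    that [v] is within O(1/N) of the game value. Some pair of positional
    strategies is optimal for arbitrarily large [N]; along its edges the game
    value moves monotonically, and [N * v] is a potential making each reward,
    up to [e], at least (resp. at most) the game value.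

    In [Red G] one passage through the gadget of [e] takes 3M steps and earns
    [erew e] on average, so these potentials extend to the gadgets with drift
    (game value)/(3M). A process with bounded increments and positive drift is
    a.s. eventually positive (Chernoff bound and Borel-Cantelli), whatever the
    other player does. Hence player 1 ensures a.s. an average of at least
    value/(3M), and player 2 a.s. keeps it below every larger number: the sets
    Almost and Positive both consist of the states of value at least lambda. *)

(** * Potentials in mean-payoff games *)

(** Pigeonhole: if each value had a last occurrence, [f] could take no value beyond the largest of
    them. It later selects one pair of strategies that is optimal for arbitrarily large [N]. *)
Lemma infinitely_often (T : finType) (f : nat -> T) :
  exists t, forall m, exists2 n, (m <= n)%N & f n = t.
Proof.
apply: contrapT => /forallNP h.
have {}h t : exists m, forall n, (m <= n)%N -> f n <> t.
  move/existsNP: (h t) => [m hm]; exists m => n mn fn; apply: hm; exists n => //.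
have [b hb] := choice h.
pose m := \max_t b t.
by apply: (hb (f m) m) => //; exact: leq_bigmax.
Qed.

(** * Mean weights of cycles *)

Section cycle_mean.
Context {M : nat} {G : dmpg M}.
Implicit Types (f : G -> G) (u w : G -> rat).

(** Among the first [#|G|.+1] iterates two coincide, and such a repeated state lies on the cycle. *)
Lemma cycle_from_gt0 f s : (0 < #|cycle_from f s|)%N.
Proof.
have : ~~ injectiveb (fun i : 'I_(#|G|.+1) => iter i f s).
  apply/negP => /injectiveP/leq_card; rewrite card_ord ltnn //.
move=> /injectivePn [i [j]].
wlog ij : i j / (i < j)%N.
  move=> H ne e; have /orP[l|l] : (i < j)%N || (j < i)%N by rewrite -neq_ltn.
  - exact: (H i j).
  - by apply: (H j i) => //; rewrite eq_sym.
move=> _ e; apply/card_gt0P; exists (iter i f s); rewrite inE.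
rewrite fconnect_iter /=.
have {2}-> : iter i f s = iter (j - i.+1) f (f (iter i f s)).
  by rewrite -iterS -iterD subnK.
exact: fconnect_iter.
Qed.

(** [f] maps the finite cycle onto itself, so it permutes it and the sum can be reindexed. *)
Lemma cycle_from_sum f s u :
  \sum_(t in cycle_from f s) u (f t) = \sum_(t in cycle_from f s) u t.
Proof.
set C := cycle_from f s.
have sub : f @: C \subset C.
  apply/fintype.subsetP => _ /imsetP[t tC ->]; move: tC; rewrite !inE => /andP[st tt].
  rewrite (connect_trans st (fconnect1 f t)) /=.
  have {2}<- : iter (findex f (f t) t) f (f (f t)) = f t.
    by rewrite -iterSr iterS iter_findex.
  exact: fconnect_iter.
(* The preimage of [t] is the state reached just before the orbit of [t] returns to [t]. *)
have E : f @: C = C.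
  apply/eqP; rewrite finset.eqEsubset sub /=; apply/fintype.subsetP => t.
  rewrite inE => /andP[st tt]; pose i := findex f (f t) t.
  have e : iter i f (f t) = t by rewrite iter_findex.
  apply/imsetP; exists (iter i f t); last by rewrite -iterS iterSr e.
  rewrite inE (connect_trans st (fconnect_iter f i t)) /=.
  rewrite -iterS iterSr e; exact: fconnect_iter.
have inj : {in C &, injective f} by apply/imset_injP; rewrite E.
by rewrite -(big_imset u inj) E.
Qed.

(** Summed around the cycle, the last hypothesis telescopes and bounds the mean of [u] by the mean
    of [w] plus [c]. The cycle is reached from [s] in at most [#|G|] steps, each lowering [u] by at
    most [b]. *)
Lemma cycle_mean_ge f u w (N b c : rat) s : 0 <= b ->
  (forall t, u t <= u (f t) + b) ->
  (forall t, N * u t <= w t + (N - 1) * u (f t) + c) ->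
  u s <= (\sum_(t in cycle_from f s) w t) / #|cycle_from f s|%:R
         + #|G|%:R * b + c.
Proof.
move=> b0 ub uw.
have it i t : u t <= u (iter i f t) + i%:R * b.
  elim: i t => [|i IH] t; first by rewrite mul0r addr0.
  rewrite iterSr; have := ub t; have := IH (f t).
  by rewrite -natr1 mulrDl mul1r => ? ?; lra.
have : \sum_(t in cycle_from f s) N * u t <=
       \sum_(t in cycle_from f s) (w t + (N - 1) * u (f t) + c).
  by apply: ler_sum => t _; exact: uw.
rewrite !big_split /= -!mulr_sumr cycle_from_sum sumr_const -[c *+ _]mulr_natl => H.
have : \sum_(t in cycle_from f s) (u s - #|G|%:R * b) <=
       \sum_(t in cycle_from f s) u t.
  apply: ler_sum => t; rewrite inE => /andP[st _].
  rewrite lerBlDr; apply: le_trans (it (findex f s t) s) _; rewrite iter_findex // lerD2l.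
  apply: ler_wpM2r => //; rewrite ler_nat.
  exact: leq_trans (ltnW (findex_max st)) (max_card _).
rewrite sumr_const -[_ *+ _]mulr_natl.
move: H; set S := \sum_(t in _) u t; set W := \sum_(t in _) w t.
have : 0 < #|cycle_from f s|%:R :> rat by rewrite ltr0n cycle_from_gt0.
move: (#|_|%:R) (#|G|%:R) => k d k0 H H2.
rewrite -addrA -lerBlDr ler_pdivlMr //. lra.
Qed.

End cycle_mean.

(** * Discounted value iteration *)

Section value_iteration.
Context {M : nat} {G : dmpg M}.
Implicit Types (N : rat) (v : G -> rat) (s t : G).

(** This is [N] times the discounted payoff of the edge, normalised so that values stay in [0, M];
    [improve] divides by [N]. *)
Definition backup N v s t : rat := (dreward G s t)%:R + (N - 1) * v t.

Definition any_successor s : G := xchoose (dedge_total s).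

Definition best_successor N v s : G :=
  if downer G s is Player1
  then [arg max_(t > any_successor s | dedge G s t) backup N v s t]%O
  else [arg min_(t < any_successor s | dedge G s t) backup N v s t]%O.

Lemma best_successor_edge N v s : dedge G s (best_successor N v s).
Proof.
have sP : dedge G s (any_successor s) := xchooseP (dedge_total s).
rewrite /best_successor; case: (downer G s).
- by case: arg_maxP.
- by case: arg_minP.
Qed.

Lemma best_successor_max N v s t : downer G s = Player1 -> dedge G s t ->
  backup N v s t <= backup N v s (best_successor N v s).
Proof.
have sP : dedge G s (any_successor s) := xchooseP (dedge_total s).
by move=> o e; rewrite /best_successor o; case: arg_maxP => // i _; exact.
Qed.

Lemma best_successor_min N v s t : downer G s = Player2 -> dedge G s t ->
  backup N v s (best_successor N v s) <= backup N v s t.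
Proof.
have sP : dedge G s (any_successor s) := xchooseP (dedge_total s).
by move=> o e; rewrite /best_successor o; case: arg_minP => // i _; exact.
Qed.

Definition improve N v s : rat := backup N v s (best_successor N v s) / N.

Lemma improve_mono N v v' : 1 <= N -> (forall s, v s <= v' s) ->
  forall s, improve N v s <= improve N v' s.
Proof.
move=> N1 vv s; rewrite ler_wpM2r ?invr_ge0 ?(le_trans ler01) //.
have bb t : backup N v s t <= backup N v' s t.
  by rewrite lerD2l ler_wpM2l ?subr_ge0.
case o : (downer G s).
- by apply: le_trans (bb _) _; apply: best_successor_max => //; exact: best_successor_edge.
- apply: le_trans (bb _); apply: best_successor_min => //; exact: best_successor_edge.
Qed.

(* A nondecreasing bounded iteration has a step at which it moves little. *)
Lemma approximate_fixpoint N (d : rat) : 1 <= N -> 0 < d ->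
  exists v, forall s, [/\ 0 <= v s, v s <= M%:R, v s <= improve N v s
    & improve N v s <= v s + d].
Proof.
move=> N1 d0; pose V k := iter k (improve N) (fun=> 0).
have N0 : 0 < N by exact: lt_le_trans N1.
have V0 k s : 0 <= V k s.
  elim: k s => [|k IH] s //=; rewrite divr_ge0 ?(ltW N0) // addr_ge0 //.
  by rewrite mulr_ge0 ?subr_ge0.
have VM k s : V k s <= M%:R.
  elim: k s => [|k IH] s /=; first by rewrite ler0n.
  rewrite ler_pdivrMr // /backup.
  have : (dreward G s (best_successor N (V k) s))%:R <= M%:R :> rat.
    by rewrite ler_nat dreward_le // best_successor_edge.
  have : (N - 1) * V k (best_successor N (V k) s) <= (N - 1) * M%:R.
    by rewrite ler_wpM2l ?subr_ge0.
  rewrite /V; lra.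
have Vmono k s : V k s <= V k.+1 s.
  by elim: k s => [|k IH] s; [exact: V0|exact: improve_mono].
suff [k hk] : exists k, forall s, V k.+1 s <= V k s + d.
  by exists (V k) => s; split; [exact: V0|exact: VM|exact: Vmono|exact: hk].
apply: contrapT => /forallNP h.
(* One state gains more than [d] and, by [Vmono], none loses; so the sum of the values would outgrow
   its bound. *)
have step k : d <= \sum_s (V k.+1 s - V k s).
  move/existsNP: (h k) => [s /negP]; rewrite -ltNge => hs.
  rewrite (bigD1 s) //= -[d]addr0 lerD //; first by rewrite lerBrDl ltW.
  by apply: sumr_ge0 => t _; rewrite subr_ge0.
have tot k : k%:R * d <= \sum_s V k s.
  elim: k => [|k IH]; first by rewrite mul0r sumr_ge0.
  have := step k; rewrite sumrB -natr1 mulrDl mul1r => hk; lra.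
have : \sum_(s : G) M%:R / d < (Num.bound (\sum_(s : G) M%:R / d : rat))%:R.
  by apply: archi_boundP; apply: sumr_ge0 => s _; rewrite divr_ge0 // ltW.
move: (Num.bound _) => k.
rewrite -mulr_suml ltr_pdivrMr // => hk; have := tot k.
have : \sum_s V k s <= \sum_(s : G) M%:R by apply: ler_sum => s _.
by move=> ? ?; lra.
Qed.

(** Only player [i] is bound by [sigma], so inequalities along consistent edges hold against every
    behaviour of the opponent. *)
Definition consistent {i} (sigma : positional G i) s t : Prop :=
  dedge G s t /\ (downer G s = i -> t = val sigma s).

(** Only the second inequality carries an error, because value iteration approaches its limit from
    below. *)
Record almost_optimal N v (sigma1 : positional G Player1)
    (sigma2 : positional G Player2) : Prop := AlmostOptimal {
  almost_optimal_ge0 : forall s, 0 <= v s;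
  almost_optimal_leM : forall s, v s <= M%:R;
  almost_optimal1 : forall s t, consistent sigma1 s t ->
    N * v s <= (dreward G s t)%:R + (N - 1) * v t;
  almost_optimal2 : forall s t, consistent sigma2 s t ->
    (dreward G s t)%:R + (N - 1) * v t <= N * v s + N^-1 }.

Definition best_positional i N v : positional G i.
Proof.
exists [ffun s => best_successor N v s].
by apply/forallP => s; rewrite ffunE best_successor_edge implybT.
Defined.

Lemma almost_optimal_exists N : 1 <= N ->
  exists v sigma1 sigma2, almost_optimal N v sigma1 sigma2.
Proof.
move=> N1; have N0 : 0 < N by exact: lt_le_trans N1.
(* Multiplication by [N] turns this tolerance into the [N^-1] of [almost_optimal2]. *)
have [|v hv] := @approximate_fixpoint N (N^-1 / N) N1; first by rewrite divr_gt0 ?invr_gt0.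
exists v, (best_positional Player1 N v), (best_positional Player2 N v).
split=> [s|s|s t [st h]|s t [st h]]; try by case: (hv s).
- have [_ _ + _] := hv s; rewrite /improve ler_pdivlMr // mulrC => /le_trans; apply.
  rewrite -/(backup N v s t); case o : (downer G s); last exact: best_successor_min.
  by rewrite (h o) /= ffunE.
- have [_ _ _] := hv s; rewrite /improve ler_pdivrMr // mulrDl divfK ?gt_eqF //.
  rewrite [v s * N]mulrC; apply: le_trans.
  rewrite -/(backup N v s t); case o : (downer G s); first exact: best_successor_max.
  by rewrite (h o) /= ffunE.
Qed.

Lemma consistent_successor1 (sigma1 : positional G Player1)
    (sigma2 : positional G Player2) s :
  consistent sigma1 s (successor sigma1 sigma2 s).
Proof.
rewrite /successor; case o : (downer G s); split=> //; last by rewrite o.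
- by move/forallP: (valP sigma1) => /(_ s); rewrite o eqxx.
- by move/forallP: (valP sigma2) => /(_ s); rewrite o eqxx.
Qed.

Lemma consistent_successor2 (sigma1 : positional G Player1)
    (sigma2 : positional G Player2) s :
  consistent sigma2 s (successor sigma1 sigma2 s).
Proof.
split; first by case: (consistent_successor1 sigma1 sigma2 s).
by rewrite /successor => ->.
Qed.

Lemma dreward_leM s t : dedge G s t -> (dreward G s t)%:R <= M%:R :> rat.
Proof. by move=> st; rewrite ler_nat dreward_le. Qed.

(** At most [#|G|] steps lead to the cycle, each changing [v] by at most [M.+1 / N]; the final 1
    covers the error [N^-1]. *)
Let slack : rat := #|G|%:R * M.+1%:R + 1.

Lemma almost_optimal_value N v sigma1 sigma2 s : 1 <= N ->
  almost_optimal N v sigma1 sigma2 ->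
  v s - slack / N <= game_value s <= v s + slack / N.
Proof.
move=> N1 [v0 vM vw wv]; have N0 : 0 < N by exact: lt_le_trans N1.
have sl0 : 0 <= slack / N.
  by rewrite divr_ge0 ?(ltW N0) // /slack addr_ge0 ?mulr_ge0.
have dr0 a b : 0 <= (dreward G a b)%:R :> rat by rewrite ler0n.
have play1 tau : v s - slack / N <= play_value s sigma1 tau.
  rewrite /play_value; set f := successor _ _.
  have cf t : consistent sigma1 t (f t) by exact: consistent_successor1.
  (* The drop of [v] along an edge is at most [M / N], as rewards are at most [M] and [v] is
     nonnegative. *)
  have := @cycle_mean_ge M G f v (fun t => (dreward G t (f t))%:R) N (M%:R / N) 0 s.
  rewrite -natr_sum.
  have -> : #|G|%:R * (M%:R / N) = (slack - #|G|%:R - 1) / N.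
    by rewrite mulrA /slack -natr1; congr (_ / N); ring.
  have : 0 <= #|G|%:R / N + N^-1 by rewrite addr_ge0 ?divr_ge0 ?invr_ge0 // ltW.
  rewrite !mulrBl mul1r => h0 H; rewrite lerBlDr.
  apply: le_trans (H _ _ _) _.
  - by rewrite divr_ge0 // ltW.
  - move=> t; rewrite -lerBlDl ler_pdivlMr // mulrC; have := vw _ _ (cf t).
    have := dreward_leM _ _ (proj1 (cf t)); have := v0 (f t); lra.
  - by move=> t; rewrite addr0; exact: vw.
  - by rewrite addr0 lerD2l -addrA -opprD gerBl.
have play2 tau : play_value s tau sigma2 <= v s + slack / N.
  rewrite /play_value; set f := successor _ _.
  have cf t : consistent sigma2 t (f t) by exact: consistent_successor2.
  (* The signs are reversed for player 2; [v] rises by at most [M.+1 / N], from [v <= M] and the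
     error [N^-1 <= 1]. *)
  have := @cycle_mean_ge M G f (fun t => - v t) (fun t => - (dreward G t (f t))%:R)
     N (M.+1%:R / N) N^-1 s.
  rewrite sumrN -natr_sum mulNr.
  have -> : #|G|%:R * (M.+1%:R / N) = (slack - 1) / N by rewrite /slack addrK mulrA.
  rewrite mulrBl mul1r => H.
  rewrite -lerN2 opprD; rewrite lerBlDr; apply: le_trans (H _ _ _) _.
  - by rewrite divr_ge0 // ltW.
  - move=> t; rewrite -lerBlDl ler_pdivlMr // mulrC -natr1; have := wv _ _ (cf t).
    have := dr0 t (f t); have := vM (f t).
    have : N^-1 <= 1 by rewrite invf_le1.
    lra.
  - by move=> t; have := wv _ _ (cf t); lra.
  - by rewrite addrA subrK.
apply/andP; split.
(* The defaults [M] of the minimum and 0 of the maximum are harmless because [0 <= v s <= M]. *)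
- rewrite /game_value; apply: le_trans (le_bigmax _ _ sigma1).
  apply: le_bigmin => //.
  apply: le_trans (vM s); by rewrite lerBlDr lerDl.
- rewrite /game_value; apply: bigmax_le.
    exact: addr_ge0.
  move=> tau _; apply: le_trans (play2 tau).
  exact: bigmin_le.
Qed.

(** The strategies are fixed before [e]; only the potential depends on it. Thus the lifted
    strategies serve all thresholds at once. *)
Theorem potential_exists :
  exists (sigma1 : positional G Player1) (sigma2 : positional G Player2),
  forall e : rat, 0 < e -> exists h : G -> rat,
    (forall s t, consistent sigma1 s t -> game_value s <= game_value t /\
       game_value s - e <= (dreward G s t)%:R + h t - h s) /\
    (forall s t, consistent sigma2 s t -> game_value t <= game_value s /\
       (dreward G s t)%:R + h t - h s <= game_value s + e).
Proof.
have [x hx] := choice (fun n : nat => almost_optimal_exists (n.+1%:R) (ler1n _ _ : 1 <= n.+1%:R)).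
have {x hx}[v [sig hv]] : exists (v : nat -> G -> rat)
    (sig : nat -> positional G Player1 * positional G Player2),
    forall n, almost_optimal n.+1%:R (v n) (sig n).1 (sig n).2.
  have [y hy] := choice hx; have [z hz] := choice hy.
  by exists x, (fun n => (y n, z n)).
have [[sigma1 sigma2] often] := infinitely_often _ sig.
exists sigma1, sigma2.
(* Two comparisons of [u] with the game value cost [slack / N] each, and one edge costs
   [M.+1 / N]. *)
pose K := slack + slack + M.+1%:R.
have K0 : 0 <= K by rewrite /K /slack !addr_ge0 // mulr_ge0.
have small e : 0 < e -> exists N u, [/\ 1 <= N, K / N < e & almost_optimal N u sigma1 sigma2].
  move=> e0; have [n mn sn] := often (Num.bound (K / e)).
  exists n.+1%:R, (v n); split; rewrite ?ler1n //; last by have := hv n; rewrite sn.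
  rewrite ltr_pdivrMr // mulrC -ltr_pdivrMr //.
  apply: lt_trans (archi_boundP _) _; first by rewrite divr_ge0 // ltW.
  by rewrite ltr_nat ltnS.
(* The game value does not depend on [N], so an inequality that holds up to every [e] is exact. *)
have mono1 s t : consistent sigma1 s t -> game_value s <= game_value t.
  move=> st; apply/ler_addgt0Pr => e e0; have [N [u [N1 KN ao]]] := small e e0.
  have N0 : 0 < N by exact: lt_le_trans N1.
  have /andP[_ us] := almost_optimal_value _ _ _ _ s N1 ao.
  have /andP[ut _] := almost_optimal_value _ _ _ _ t N1 ao.
  have := almost_optimal1 _ _ _ _ ao _ _ st; have := almost_optimal_ge0 _ _ _ _ ao t.
  have := dreward_leM _ _ st.1 => d u0 H.
  have {H} : u s <= u t + M.+1%:R / N.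
    by rewrite -lerBlDl ler_pdivlMr // -natr1; lra.
  have : K / N = slack / N + slack / N + M.+1%:R / N by rewrite /K !mulrDl.
  by lra.
have mono2 s t : consistent sigma2 s t -> game_value t <= game_value s.
  move=> st; apply/ler_addgt0Pr => e e0; have [N [u [N1 KN ao]]] := small e e0.
  have N0 : 0 < N by exact: lt_le_trans N1.
  have /andP[us _] := almost_optimal_value _ _ _ _ s N1 ao.
  have /andP[_ ut] := almost_optimal_value _ _ _ _ t N1 ao.
  have := almost_optimal2 _ _ _ _ ao _ _ st; have := almost_optimal_leM _ _ _ _ ao t.
  have : N^-1 <= 1 by rewrite invf_le1.
  have := ler0n rat (dreward G s t) => d n1 u0 H.
  have {H} : u t <= u s + M.+1%:R / N.
    by rewrite -lerBlDl ler_pdivlMr // -natr1; lra.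
  have : K / N = slack / N + slack / N + M.+1%:R / N by rewrite /K !mulrDl.
  by lra.
move=> e e0; have [N [u [N1 KN ao]]] := small e e0.
have N0 : 0 < N by exact: lt_le_trans N1.
have N'0 : 0 < N^-1 by rewrite invr_gt0.
have KE : K / N = slack / N + slack / N + M.+1%:R / N by rewrite /K !mulrDl.
have sl0 : 0 <= slack / N.
  by rewrite divr_ge0 ?(ltW N0) // /slack addr_ge0 ?mulr_ge0.
have M1 : N^-1 <= M.+1%:R / N by rewrite ler_peMl ?ler1n // ltW.
(* With this potential, reward plus increase is at least [u t], and at most [u t + N^-1] for player
   2; [u t] is close to the value of [t], which [mono1] and [mono2] compare with that of [s]. *)
exists (fun s => N * u s); split=> s t st; split; first exact: mono1.
- have := almost_optimal1 _ _ _ _ ao _ _ st; have := mono1 _ _ st.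
  have /andP[_] := almost_optimal_value _ _ _ _ t N1 ao.
  lra.
- exact: mono2.
- have := almost_optimal2 _ _ _ _ ao _ _ st; have := mono2 _ _ st.
  have /andP[+ _] := almost_optimal_value _ _ _ _ t N1 ao.
  lra.
Qed.

End value_iteration.

(** * Drift in stochastic games *)

Section words.
Context {T : finType}.

Fixpoint words n : seq (seq T) :=
  if n is n'.+1 then [seq x :: p | x <- enum T, p <- words n'] else [:: [::]].

Lemma mem_words p : p \in words (size p).
Proof.
by elim: p => [|x p IH] //=; apply: allpairs_f => //; rewrite mem_enum.
Qed.

Lemma big_words {R : realType} n (P : pred (seq T)) (F : seq T -> R) :
  \sum_(p <- words n.+1 | P p) F p =
  \sum_x \sum_(p <- words n | P (x :: p)) F (x :: p).
Proof.
rewrite /= big_mkcond big_allpairs_dep big_enum /=.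
by apply: eq_bigr => x _; rewrite [RHS]big_mkcond.
Qed.

End words.

(** From [1 - x <= expR (- x)] follows [expR x <= 1 / (1 - x)], and
    [(1 - x) * (1 + x + 2 * x ^+ 2) >= 1] for [x <= 1 / 2]. *)
Lemma expR_le_quadratic {R : realType} (x : R) :
  x <= 2^-1 -> expR x <= 1 + x + 2 * x ^+ 2.
Proof.
move=> x2; have := expR_ge1Dx (- x); rewrite expRN => h.
have e0 := expR_gt0 x.
have : (1 - x) * expR x <= 1 by rewrite -ler_pdivlMr // div1r.
have : 1 <= (1 - x) * (1 + x + 2 * x ^+ 2).
  have -> : (1 - x) * (1 + x + 2 * x ^+ 2) = 1 + x ^+ 2 * (1 - 2 * x) by ring.
  by rewrite lerDl mulr_ge0 ?sqr_ge0 //; lra.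
move=> h1 h2; rewrite -(@ler_pM2l _ (1 - x)); last by lra.
exact: le_trans h1.
Qed.

Lemma fdist_mean_ge {R : realType} {T : finType} (d : fdist R T) (f : T -> R) a :
  (forall t, 0 < d t -> a <= f t) -> a <= \sum_t d t * f t.
Proof.
move=> h; rewrite -[a]mul1r -(fdist_sum1 d) mulr_suml; apply: ler_sum => t _.
have := fdist_ge0 d t; rewrite le_eqVlt => /predU1P[<-|d0]; first by rewrite !mul0r.
by rewrite ler_wpM2l ?(ltW d0) ?h.
Qed.

Lemma fdist_mean_le {R : realType} {T : finType} (d : fdist R T) (f : T -> R) a :
  (forall t, 0 < d t -> f t <= a) -> \sum_t d t * f t <= a.
Proof.
move=> h; have := @fdist_mean_ge R T d (fun t => - f t) (- a).
under eq_bigr do rewrite mulrN.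
by rewrite sumrN lerN2; apply=> t /h; rewrite lerN2.
Qed.

Section drift.
Local Open Scope classical_set_scope.
Context {R : realType} {G : tbsg R} (s : G).
Context (sigma1 : strategy G Player1) (sigma2 : strategy G Player2).

Lemma step_edge h x y : 0 < step sigma1 sigma2 h x y -> edge G x y.
Proof.
rewrite /step; case o : (owner G x) => [[]|]; try exact: move_edge.
by rewrite edge_delta.
Qed.

Lemma path_prob_path h x p : path_prob sigma1 sigma2 h x p != 0 -> path (edge G) x p.
Proof.
elim: p h x => [|y p IH] h x //=; rewrite mulf_eq0 negb_or => /andP[st pp].
apply/andP; split; last exact: IH pp.
by apply: (@step_edge h); rewrite lt0r st fdist_ge0.
Qed.

(** Written as a finite union of cylinders, the event is visibly measurable and its probability is
    bounded by a finite sum. *)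
Definition prefix_event (P : pred (seq G)) n : set (seqs_mtype s) :=
  \big[setU/set0]_(p <- words n | P p) cylinder p.

Lemma prefix_eventE P n w : prefix_event P n w <-> P (mkseq w n).
Proof.
rewrite /prefix_event -bigcup_seq_cond /=; split => [[p]|Pw].
  rewrite /cylinder /= => /andP[pn Pp] wp.
  have sz : size p = n.
    elim: n p pn {Pp wp} => [|n IH] p; first by rewrite inE => /eqP ->.
    by move=> /allpairsP[[x q] [_ /IH + ->]] /= => ->.
  by rewrite -sz wp.
exists (mkseq w n); rewrite /cylinder /= ?size_mkseq // Pw andbT.
by rewrite -{2}(size_mkseq w n) mem_words.
Qed.

Lemma measurable_cylinder p : measurable (cylinder p : set (seqs_mtype s)).
Proof. by apply: sub_sigma_algebra; exists p. Qed.

Lemma measurable_prefix_event P n : measurable (prefix_event P n).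
Proof. by apply: bigsetU_measurable => p _; exact: measurable_cylinder. Qed.

Lemma Pr_prefix_event P n :
  (Pr s sigma1 sigma2 (prefix_event P n.+1) <=
   (\sum_(q <- words n | P (s :: q)) path_prob sigma1 sigma2 [::] s q)%:E)%E.
Proof.
have -> : \sum_(q <- words n | P (s :: q)) path_prob sigma1 sigma2 [::] s q =
    \sum_(p <- words n.+1 | P p) prefix_prob s sigma1 sigma2 p.
  rewrite big_words (bigD1 s) //= eqxx [X in _ = _ + X]big1 ?addr0; last first.
    by move=> x /negbTE xs; rewrite big1 // => q _; rewrite xs mul0r.
  by apply: eq_bigr => q _; rewrite mul1r.
rewrite /prefix_event; elim: (words n.+1) => [|p r IH].
  by rewrite !big_nil measure0.
rewrite !big_cons; case: ifP => // _.
rewrite EFinD -(Pr_cylinder s sigma1 sigma2 p).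
apply: le_trans (measureU2 _ _ _) _.
- exact: measurable_cylinder.
- by apply: bigsetU_measurable => q _; exact: measurable_cylinder.
- by rewrite leeD2l.
Qed.

Lemma ae_is_play : {ae Pr s sigma1 sigma2, forall w : seqs_mtype s, is_play w}.
Proof.
pose P (p : seq G) := ~~ sorted (edge G) p.
have H n : {ae Pr s sigma1 sigma2, forall w : seqs_mtype s, sorted (edge G) (mkseq w n.+1)}.
  exists (prefix_event P n.+1); split; first exact: measurable_prefix_event.
    apply/eqP; rewrite eq_le measure_ge0 andbT.
    apply: le_trans (Pr_prefix_event P n) _; rewrite lee_fin big1 // => q.
    by move=> /=; apply: contraNeq; exact: path_prob_path.
  by move=> w /= /negP h; apply/prefix_eventE.
have := ae_foralln H; apply: filterS => w hw n.
have /(sortedP (w 0%N))/(_ n) := hw n.+1.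
by rewrite size_mkseq !nth_mkseq // => ->.
Qed.

(** * Positive drift: exponential moments and Borel-Cantelli *)

Context (inc : G -> G -> R) (good : G -> Prop) (eta : R).
Hypothesis eta0 : 0 < eta.
Hypothesis good_start : good s.
Hypothesis good_step : forall h x y, good x -> 0 < step sigma1 sigma2 h x y -> good y.
Hypothesis good_drift : forall h x, good x ->
  eta <= \sum_y step sigma1 sigma2 h x y * inc x y.

Let psum (p : seq G) : R := \sum_(i < (size p).-1) inc (nth s p i) (nth s p i.+1).

(** A crude bound on the increments; the summand [eta] ensures [0 < eta <= B]. *)
Let B : R := \sum_x \sum_y `|inc x y| + eta.

Let inc_le x y : `|inc x y| <= B.
Proof.
rewrite /B (bigD1 x) //= (bigD1 y) //= -!addrA lerDl addr_ge0 ?sumr_ge0 //.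
by rewrite addr_ge0 ?(ltW eta0) // sumr_ge0 // => z _; rewrite sumr_ge0.
Qed.

Let eta_le : eta <= B.
Proof. by rewrite lerDr; apply: sumr_ge0 => x _; exact: sumr_ge0. Qed.

Let B0 : 0 < B. Proof. exact: lt_le_trans eta_le. Qed.

(** The minimiser of [1 - theta * eta + 2 * theta ^+ 2 * B ^+ 2]; the minimum is [rho]. *)
Let theta : R := eta / (4 * B ^+ 2).
Let rho : R := 1 - eta ^+ 2 / (8 * B ^+ 2).

Let rho01 : 0 < rho < 1.
Proof.
have B2 : 0 < 8 * B ^+ 2 by rewrite mulr_gt0 // exprn_gt0.
rewrite subr_gt0 ltr_pdivrMr // ltrBlDr ltrDl divr_gt0 ?exprn_gt0 // andbT mul1r.
have : eta ^+ 2 <= B ^+ 2 by rewrite lerXn2r // ?nnegrE ltW.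
have := exprn_gt0 2 B0; lra.
Qed.

Let exp_step h x : good x ->
  \sum_y step sigma1 sigma2 h x y * expR (- theta * inc x y) <= rho.
Proof.
move=> gx.
have B2 : 0 < B ^+ 2 by rewrite exprn_gt0.
have th0 : 0 <= theta by rewrite ltW // divr_gt0 // mulr_gt0.
have thB : theta * B <= 2^-1.
  rewrite /theta mulrAC ler_pdivrMr ?mulr_gt0 //.
  have : eta * B <= B ^+ 2 by rewrite expr2 ler_pM2r.
  lra.
have bnd y : expR (- theta * inc x y) <=
    1 - theta * inc x y + 2 * theta ^+ 2 * B ^+ 2.
  have i1 : `|theta * inc x y| <= theta * B.
    by rewrite normrM ger0_norm // ler_wpM2l.
  apply: le_trans (expR_le_quadratic _ _) _.
    rewrite mulNr; apply: le_trans (ler_norm _) _; rewrite normrN.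
    exact: le_trans thB.
  rewrite mulNr lerD2l sqrrN -mulrA ler_pM2l // -exprMn -real_normK ?num_real //.
  by rewrite lerXn2r // ?nnegrE // mulr_ge0 // ltW.
apply: (@le_trans _ _ (\sum_y step sigma1 sigma2 h x y *
    (1 - theta * inc x y + 2 * theta ^+ 2 * B ^+ 2))).
  by apply: ler_sum => y _; rewrite ler_wpM2l ?fdist_ge0.
have -> : \sum_y step sigma1 sigma2 h x y *
    (1 - theta * inc x y + 2 * theta ^+ 2 * B ^+ 2) =
  1 + 2 * theta ^+ 2 * B ^+ 2 - theta * (\sum_y step sigma1 sigma2 h x y * inc x y).
  rewrite -[X in X + _ - _](fdist_sum1 (step sigma1 sigma2 h x)).
  rewrite -[X in _ + X - _]mul1r -[X in _ + X * _ - _](fdist_sum1 (step sigma1 sigma2 h x)).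
  rewrite mulr_suml mulr_sumr -big_split -sumrB /=; apply: eq_bigr => y _; ring.
have := good_drift h _ gx; set E := \sum_y _ => hE.
have : theta * eta <= theta * E by rewrite ler_wpM2l.
have : 2 * theta ^+ 2 * B ^+ 2 - theta * eta = - (eta ^+ 2 / (8 * B ^+ 2)).
  by rewrite /theta; field; rewrite gt_eqF.
rewrite /rho; lra.
Qed.

(** Conditioning on the first step splits off one factor, bounded by [exp_step]; steps of positive
    probability stay in [good], whatever the history. *)
Let exp_moment n h x : good x ->
  \sum_(q <- words n) path_prob sigma1 sigma2 h x q * expR (- theta * psum (x :: q))
    <= rho ^+ n.
Proof.
have /andP[/ltW r0 _] := rho01.
elim: n h x => [|n IH] h x gx.
  by rewrite /= big_seq1 mul1r /psum /= big_ord0 mulr0 expR0.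
rewrite big_words /=.
apply: (@le_trans _ _ (\sum_y step sigma1 sigma2 h x y * expR (- theta * inc x y) * rho ^+ n)).
  apply: ler_sum => y _.
  have := fdist_ge0 (step sigma1 sigma2 h x) y; rewrite le_eqVlt => /predU1P[<-|st].
    by rewrite !mul0r big1 // => q _; rewrite !mul0r.
  apply: le_trans (ler_wpM2l _ (IH (rcons h x) y (good_step _ _ _ gx st))).
    rewrite mulr_sumr le_eqVlt; apply/orP; left; apply/eqP; apply: eq_bigr => q _.
    have -> : psum (x :: y :: q) = inc x y + psum (y :: q).
      by rewrite /psum /= big_ord_recl.
    by rewrite mulrDr expRD mulrACA.
  by rewrite mulr_ge0 ?expR_ge0 // ltW.
by rewrite -mulr_suml exprS ler_wpM2r ?exprn_ge0 // exp_step.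
Qed.

Lemma ae_drift : {ae Pr s sigma1 sigma2, forall w : seqs_mtype s,
  \forall n \near \oo, 0 < \sum_(i < n) inc (w i) (w i.+1)}.
Proof.
have /andP[r0 r1] := rho01.
have B2 : 0 < B ^+ 2 by rewrite exprn_gt0.
have th0 : 0 <= theta by rewrite ltW // divr_gt0 // mulr_gt0.
pose P p := psum p <= 0; pose F n := prefix_event P n.+1.
have mF n : measurable (F n) by exact: measurable_prefix_event.
(* Markov's inequality: on [F n] the exponential in [exp_moment] is at least 1. *)
have bound n : (Pr s sigma1 sigma2 (F n) <= (rho ^+ n)%:E)%E.
  apply: le_trans (Pr_prefix_event P n) _; rewrite lee_fin.
  apply: le_trans (exp_moment n [::] s good_start).
  rewrite [leRHS](bigID (fun q => P (s :: q))) /= -[leLHS]addr0.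
  apply: lerD; last first.
    by apply: sumr_ge0 => q _; rewrite mulr_ge0 ?expR_ge0 ?path_prob_ge0.
  apply: ler_sum => q Pq; rewrite -[leLHS]mulr1 ler_wpM2l ?path_prob_ge0 //.
  by rewrite -expR0 ler_expR mulNr -mulrN mulr_ge0 // oppr_ge0.
exists (lim_sup_set F); split.
- apply: bigcapT_measurable => n; exact: bigcup_measurable.
- apply: lim_sup_set_cvg0 => //.
  apply: (@le_lt_trans _ _ (1 * (1 - rho)^-1)%:E); last exact: ltry.
  apply: lime_le; first by apply: is_cvg_nneseries => n _ _.
  apply: nearW => n; have := @geometric_le_lim R n 1 rho ler01.
  rewrite ger0_norm ?(ltW r0) // => /(_ r0 r1) H.
  apply: (@le_trans _ _ (series (geometric 1 rho) n)%:E); last by rewrite lee_fin.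
  rewrite /series /= -sumEFin; apply: lee_sum => i _.
  by apply: le_trans (bound i) _; rewrite mul1r.
- move=> w /= h n _.
  apply: contrapT => nF; apply: h; exists n => // m /= nm.
  rewrite ltNge; apply/negP => le0; apply: nF; exists m => //.
  apply/prefix_eventE; rewrite /P /psum size_mkseq.
  apply: le_trans le0; rewrite le_eqVlt; apply/orP; left; apply/eqP.
  apply: eq_bigr => i _; have im := leqW (ltn_ord i).
  by rewrite !nth_mkseq //; exact: ltn_ord i.
Qed.

End drift.

(** * Almost sure bounds on averages *)

Section mean.
Local Open Scope classical_set_scope.
Context {R : realType} {G : tbsg R} (s : G).
Context (sigma1 : strategy G Player1) (sigma2 : strategy G Player2).
Context (good : G -> Prop).
Hypothesis good_start : good s.
Hypothesis good_step : forall h x y, good x -> 0 < step sigma1 sigma2 h x y -> good y.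

(** [ae_drift] applies to the increments [r x y + H y - H x - b] with [b] halfway between [q] and
    [a]. The [H] terms telescope to a bounded quantity, which [n * (b - q)] eventually absorbs. *)
Lemma ae_mean_ge (r : G -> G -> R) (H : G -> R) (a q : R) :
  (forall h x, good x ->
    a <= \sum_y step sigma1 sigma2 h x y * (r x y + H y - H x)) -> q < a ->
  {ae Pr s sigma1 sigma2, forall w : seqs_mtype s,
 \forall n \near \oo, q <= (\sum_(i < n) r (w i) (w i.+1)) / n%:R}.
Proof.
move=> drift qa; pose b := (q + a) / 2.
have := @ae_drift R G s sigma1 sigma2 (fun x y => r x y + H y - H x - b) good (a - b).
have ab0 : 0 < a - b by rewrite /b; lra.
move=> /(_ ab0 good_start good_step).
have D h x : good x -> a - b <=
    \sum_y step sigma1 sigma2 h x y * (r x y + H y - H x - b).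
  move=> gx; under eq_bigr do rewrite mulrBr.
  by rewrite sumrB -mulr_suml fdist_sum1 mul1r lerD2r drift.
move=> /(_ D); apply: filterS => w hw.
pose C := \sum_x `|H x|.
have HC x : `|H x| <= C.
  by rewrite /C (bigD1 x) //= lerDl sumr_ge0.
have C0 : 0 <= C by rewrite sumr_ge0.
have bq0 : 0 < b - q by rewrite /b; lra.
have tel n : \sum_(i < n) (r (w i) (w i.+1) + H (w i.+1) - H (w i) - b) =
    \sum_(i < n) r (w i) (w i.+1) + H (w n) - H (w 0%N) - n%:R * b.
  elim: n => [|n IH]; first by rewrite !big_ord0; ring.
  rewrite !big_ord_recr /= IH -natr1; ring.
near=> n.
have n0 : 0 < n%:R :> R by rewrite ltr0n; near: n; exact: nbhs_infty_gt.
rewrite ler_pdivlMr //.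
have : 0 < \sum_(i < n) (r (w i) (w i.+1) + H (w i.+1) - H (w i) - b).
  by near: n.
rewrite tel.
have := ler_norm (H (w n)); have := HC (w n).
have := ler_norm (- H (w 0%N)); rewrite normrN; have := HC (w 0%N).
have : C + C <= n%:R * (b - q).
  rewrite -ler_pdivrMr //; near: n; exact: nbhs_infty_ger.
by move: (\sum_(i < n) _) => S; lra.
Unshelve. all: by end_near. Qed.

Lemma ae_mean_le (r : G -> G -> R) (H : G -> R) (a q : R) :
  (forall h x, good x ->
    \sum_y step sigma1 sigma2 h x y * (r x y + H y - H x) <= a) -> a < q ->
  {ae Pr s sigma1 sigma2, forall w : seqs_mtype s,
 \forall n \near \oo, (\sum_(i < n) r (w i) (w i.+1)) / n%:R <= q}.
Proof.
move=> drift aq.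
have D h x : good x -> - a <= \sum_y step sigma1 sigma2 h x y * (- r x y + - H y - - H x).
  move=> gx; rewrite lerNl -sumrN; apply: le_trans (drift h x gx).
  by apply: ler_sum => y _; rewrite -mulrN -!opprD opprK.
have := @ae_mean_ge (fun x y => - r x y) (fun x => - H x) (- a) (- q) D.
rewrite ltrN2 => /(_ aq); apply: filterS => w; apply: filterS => n.
by rewrite sumrN mulNr lerN2.
Qed.

End mean.

Section liminf.
Local Open Scope classical_set_scope.
Context {R : realType}.
Implicit Types (u : nat -> R) (a : R).

(** Countably many tolerances suffice, so almost sure bounds, one per [k], can be combined. *)
Lemma limn_einf_ge u a :
  (forall k, \forall n \near \oo, a - k.+1%:R^-1 <= u n) ->
  (a%:E <= limn_einf (fun n => (u n)%:E))%E.
Proof.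
move=> h; apply/lee_addgt0Pr => e e0.
have [k ke] : exists k, k.+1%:R^-1 <= e.
  exists (Num.bound e^-1); rewrite -[leRHS]invrK lef_pV2 ?posrE ?invr_gt0 //.
  by apply: le_trans (ltW (archi_boundP _)) _; rewrite ?ler_nat // invr_ge0 ltW.
rewrite -leeBlDr // -EFinB; apply: (@le_trans _ _ (a - k.+1%:R^-1)%:E).
  by rewrite lee_fin lerD2l lerN2.
rewrite limn_einf_lim; apply: lime_ge; first exact: is_cvg_einfs.
have [m _ hm] := h k; exists m => // n mn.
by apply: le_ereal_inf_tmp => _ [p /= np <-]; rewrite lee_fin hm //=; exact: leq_trans np.
Qed.

Lemma limn_einf_le u a : (\forall n \near \oo, u n <= a) ->
  (limn_einf (fun n => (u n)%:E) <= a%:E)%E.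
Proof.
move=> h; rewrite limn_einf_lim; apply: lime_le; first exact: is_cvg_einfs.
apply: filterS h => n un; apply: (@le_trans _ _ (u n)%:E); last by rewrite lee_fin.
by apply: ereal_inf_lbound; exists n => /=.
Qed.

End liminf.

(** * The reduction *)

Section fdirac.
Context {R : realType} {T : finType} (x : T).

Let fdirac_ge0 y : 0 <= (y == x)%:R :> R. Proof. exact: ler0n. Qed.

Let fdirac_sum1 : \sum_y (y == x)%:R = 1 :> R.
Proof. by rewrite (bigD1 x) //= eqxx big1 ?addr0 // => y /negbTE ->. Qed.

Definition fdirac : fdist R T := FDist fdirac_ge0 fdirac_sum1.

Lemma fdirac_gt0 y : 0 < fdirac y -> y = x.
Proof. by rewrite /= ltr0n lt0b => /eqP. Qed.

End fdirac.

Section reduction.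
Local Open Scope classical_set_scope.
Context {R : realType} {M : nat} (M_gt0 : (0 < M)%N) {G : dmpg M}.

Local Notation G' := (Red R G M_gt0).

(** The gadget of [e] can be left only to [tgt e], so its states inherit that value. *)
Definition red_value (x : G') : rat :=
  match x with
  | inl s => game_value s
  | inr (e, _) => game_value (tgt e)
  end.

Section lift_strategy.
Context {i : player} (sigma : positional G i).

(** The Dirac mass at [x] is a dummy: at states owned by [i] the [pick] succeeds. *)
Definition lift_move (h : seq G') (x : G') : fdist R G' :=
  if x is inl s then
    if [pick e : edges G | (src e == s) && (tgt e == val sigma s)] is Some e
    then fdirac (inr (e, V1) : G') else fdirac x
  else fdirac x.

Lemma lift_moveP h s y : downer G s = i -> 0 < lift_move h (inl s) y ->
  exists e, [/\ y = inr (e, V1), src e = s & tgt e = val sigma s].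
Proof.
move=> o; rewrite /lift_move; case: pickP => [e /andP[/eqP es /eqP et]|h0].
  by move=> /fdirac_gt0 ->; exists e.
have se : dedge G s (val sigma s).
  by move/forallP: (valP sigma) => /(_ s); rewrite o eqxx.
by have := h0 (exist _ (s, val sigma s) se); rewrite /src /tgt /= !eqxx.
Qed.

Lemma lift_move_edge h (x y : G') :
  owner G' x = Some i -> 0 < lift_move h x y -> edge G' x y.
Proof.
case: x => [s|x] //; case=> ow /(lift_moveP _ _ _ ow)[e [-> es _]].
by rewrite /= es.
Qed.

Definition lift_strategy : strategy G' i := Strategy lift_move_edge.

End lift_strategy.

Lemma red_edge_inl s (y : G') : edge G' (inl s) y -> exists2 e, y = inr (e, V1) & src e = s.
Proof. by case: y => [//|[e []]] //= /eqP; exists e. Qed.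

Lemma lift_step1 (sigma1 : positional G Player1) sigma2 h s y :
  0 < step (lift_strategy sigma1) sigma2 h (inl s : G') y ->
  exists e, [/\ y = inr (e, V1), src e = s & consistent sigma1 s (tgt e)].
Proof.
move=> st; have [e ye es] := red_edge_inl _ _ (step_edge _ _ _ _ _ st).
exists e; split=> //; rewrite -es; split; first exact: (valP e).
rewrite es => ow; move: st; rewrite /step.
have -> : owner G' (inl s : G') = Some Player1 by rewrite -ow.
by move=> /(lift_moveP _ _ _ _ ow)[e' []]; rewrite ye => -[<-].
Qed.

Lemma lift_step2 sigma1 (sigma2 : positional G Player2) h s y :
  0 < step sigma1 (lift_strategy sigma2) h (inl s : G') y ->
  exists e, [/\ y = inr (e, V1), src e = s & consistent sigma2 s (tgt e)].
Proof.
move=> st; have [e ye es] := red_edge_inl _ _ (step_edge _ _ _ _ _ st).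
exists e; split=> //; rewrite -es; split; first exact: (valP e).
rewrite es => ow; move: st; rewrite /step.
have -> : owner G' (inl s : G') = Some Player2 by rewrite -ow.
by move=> /(lift_moveP _ _ _ _ ow)[e' []]; rewrite ye => -[<-].
Qed.

(* Inside the gadgets the extension is forced by requiring that reward plus
   increase of potential have mean exactly [g / (3M)]. *)
Definition lift_potential (h : G -> R) (g : R) (x : G') : R :=
  match x with
  | inl s => h s
  | inr (e, v) =>
      let c := (erew e)%:R - g + h (tgt e) in
      let d := (1 - M%:R^-1) * c + M%:R^-1 * h (tgt e) - g / (3 * M)%:R in
      match v with
      | V1 => c + g / (3 * M)%:R
      | V2 => 1 + d
      | V3 => d
      | V4 => c
      end
  end.

Definition reward (x y : G') : R := (red_reward G x y)%:R.

(** At [V2], [V3] and [V4] this holds by construction; the equation at [V1] closes the loop and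
    determines [c]. *)
Lemma lift_potential_gadget h g e v :
  \sum_y red_prob R (inr (e, v)) y * (reward (inr (e, v)) y
      + lift_potential h g y - lift_potential h g (inr (e, v))) = g / (3 * M)%:R.
Proof.
have M0 : (M%:R : R) != 0 by rewrite pnatr_eq0 -lt0n.
have mass (F : G' -> R) a z : \sum_y a * (y == z)%:R * F y = a * F z.
  rewrite (bigD1 z) //= eqxx mulr1 big1 ?addr0 // => y /negbTE ->.
  by rewrite mulr0 mul0r.
have mass1 (F : G' -> R) z : \sum_y (y == z)%:R * F y = F z.
  by rewrite -[RHS]mul1r -mass; apply: eq_bigr => y _; rewrite mul1r.
case: v; rewrite /red_prob.
1-3: under eq_bigr do rewrite mulrDl.
1-3: rewrite big_split /= !mass.
4: rewrite mass1.
all: rewrite /reward /= ?natrB ?erew_le // !natrM.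
all: by field.
Qed.

(** Entering a gadget thus has drift at least [g / (3M)] exactly when [h] is a potential for [g]
    along [e] in [G]. *)
Lemma lift_potential_source h g e :
  reward (inl (src e)) (inr (e, V1)) + lift_potential h g (inr (e, V1))
    - lift_potential h g (inl (src e)) =
  (erew e)%:R + h (tgt e) - h (src e) - g + g / (3 * M)%:R.
Proof. rewrite /reward /=; ring. Qed.

Lemma red_step_gadget e v (x : G') : red_prob R (inr (e, v)) x != 0 ->
  (exists v', x = inr (e, v')) \/ x = inl (tgt e).
Proof.
case: v => /=.
- case: (x =P inr (e, V2)) => [->|_]; first by left; exists V2.
  by case: (x =P inr (e, V3)) => [->|_]; [left; exists V3|rewrite !mulr0 addr0 eqxx].
- case: (x =P inr (e, V4)) => [->|_]; first by left; exists V4.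
  by case: (x =P inl (tgt e)) => [->|_]; [right|rewrite !mulr0 addr0 eqxx].
- case: (x =P inr (e, V4)) => [->|_]; first by left; exists V4.
  by case: (x =P inl (tgt e)) => [->|_]; [right|rewrite !mulr0 addr0 eqxx].
- by case: (x =P inr (e, V1)) => [->|_]; [left; exists V1|rewrite eqxx].
Qed.

Lemma red_value_gadget e v (x : G') :
  0 < red_prob R (inr (e, v)) x -> red_value x = game_value (tgt e).
Proof. by move=> /lt0r_neq0/red_step_gadget[[v' ->]|->]. Qed.

Lemma ratr_potential (w : nat) (a b c : rat) :
  ratr (w%:R + a - b - c) = w%:R + ratr a - ratr b - ratr c :> R.
Proof. by rewrite !rmorphB rmorphD rmorph_nat. Qed.

(** The rational [c] lies strictly below the value of [x], and the gap serves as [e] in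
    [potential_exists]. States of value at least that of [x] are never left, so the drift
    persists. *)
Lemma ae_reward_ge (x : G') : exists tau1, forall tau2 (q : R),
  q < ratr (red_value x) / (3 * M)%:R ->
  {ae Pr x tau1 tau2, forall w : seqs_mtype x,
    \forall n \near \oo, q <= (\sum_(i < n) reward (w i) (w i.+1)) / n%:R}.
Proof.
have [sigma1 [sigma2 hp]] := @potential_exists M G.
exists (lift_strategy sigma1) => tau2 q hq.
have M3 : 0 < (3 * M)%:R :> R by rewrite ltr0n muln_gt0.
pose a := (q + ratr (red_value x) / (3 * M)%:R) / 2.
have qa : q < a by rewrite /a; lra.
have : a < ratr (red_value x) / (3 * M)%:R by rewrite /a; lra.
rewrite ltr_pdivlMr // => /rat_in_itvoo[c]; rewrite in_itv /= ltr_rat => /andP[ac cx].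
have [|h [hh _]] := hp (red_value x - c); first by rewrite subr_gt0.
pose good (y : G') : Prop := red_value x <= red_value y.
apply: (@ae_mean_ge R G' x (lift_strategy sigma1) tau2 good _ _ reward
  (lift_potential (ratr \o h) (ratr c)) a q _ qa) => [||p y gy].
- exact: lexx.
- move=> p [s|[e v]] z; rewrite /good => gy.
    move=> /lift_step1[e [-> _ st]] /=; apply: le_trans gy _.
    exact: (hh _ _ st).1.
  by move=> /red_value_gadget ->.
- have ac' : a <= ratr c / (3 * M)%:R by rewrite ler_pdivlMr // ltW.
  apply: le_trans ac' _.
  case: y gy => [s|[e v]] gy; last by rewrite lift_potential_gadget.
  apply: fdist_mean_ge => z /lift_step1[e [-> es]].
  move: gy; rewrite -es lift_potential_source lerDr -ratr_potential ler0q => gy st.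
  by have [_] := hh _ _ st; move: gy; rewrite /good /erew /= => ? ?; lra.
Qed.

(** Since [tau2] is chosen before [tau1], it defeats every strategy of player 1, as
    [Positive1_objective] requires. *)
Lemma ae_reward_le (x : G') : exists tau2, forall tau1 (q : R),
  ratr (red_value x) / (3 * M)%:R < q ->
  {ae Pr x tau1 tau2, forall w : seqs_mtype x,
    \forall n \near \oo, (\sum_(i < n) reward (w i) (w i.+1)) / n%:R <= q}.
Proof.
have [sigma1 [sigma2 hp]] := @potential_exists M G.
exists (lift_strategy sigma2) => tau1 q hq.
have M3 : 0 < (3 * M)%:R :> R by rewrite ltr0n muln_gt0.
pose a := (q + ratr (red_value x) / (3 * M)%:R) / 2.
have aq : a < q by rewrite /a; lra.
have : ratr (red_value x) / (3 * M)%:R < a by rewrite /a; lra.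
rewrite ltr_pdivrMr // => /rat_in_itvoo[c]; rewrite in_itv /= ltr_rat => /andP[xc ca].
have [|h [_ hh]] := hp (c - red_value x); first by rewrite subr_gt0.
pose good (y : G') : Prop := red_value y <= red_value x.
apply: (@ae_mean_le R G' x tau1 (lift_strategy sigma2) good _ _ reward
  (lift_potential (ratr \o h) (ratr c)) a q _ aq) => [||p y gy].
- exact: lexx.
- move=> p [s|[e v]] z; rewrite /good => gy.
    move=> /lift_step2[e [-> _ st]] /=; apply: le_trans gy.
    exact: (hh _ _ st).1.
  by move=> /red_value_gadget ->.
- have ac' : ratr c / (3 * M)%:R <= a by rewrite ler_pdivrMr // ltW.
  apply: le_trans ac'.
  case: y gy => [s|[e v]] gy; last by rewrite lift_potential_gadget.
  apply: fdist_mean_le => z /lift_step2[e [-> es]].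
  move: gy; rewrite -es lift_potential_source gerDr -ratr_potential lerq0 => gy st.
  by have [_] := hh _ _ st; move: gy; rewrite /good /erew /= => ? ?; lra.
Qed.

Definition objective (lambda : rat) : set (nat -> G') :=
  LimInfAvg G' (fun x y => nat_of_bool (red_reward G x y))
    (ratr (lambda / (3 * M)%N%:R)).

Lemma natr_sum_reward (w : nat -> G') n :
  (\sum_(i < n) nat_of_bool (red_reward G (w i) (w i.+1)))%N%:R =
  \sum_(i < n) reward (w i) (w i.+1) :> R.
Proof. by rewrite natr_sum. Qed.

Lemma Almost1_objective lambda (x : G') :
  lambda <= red_value x -> Almost1 G' (objective lambda) x.
Proof.
move=> lx; have [tau1 h1] := ae_reward_ge x; exists tau1 => tau2.
suff H : {ae Pr x tau1 tau2, forall w : seqs_mtype x, objective lambda w}.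
  rewrite -[objective lambda]setCK probability_setC.
    by rewrite (measure_negligible _ H) ?sube0 //; apply: measurableC; exact: measurable_LimInfAvg.
  by apply: measurableC; exact: measurable_LimInfAvg.
have hk k : {ae Pr x tau1 tau2, forall w : seqs_mtype x, \forall n \near \oo,
    ratr (lambda / (3 * M)%N%:R) - k.+1%:R^-1 <= (\sum_(i < n) reward (w i) (w i.+1)) / n%:R}.
  apply: h1; rewrite fmorph_div /= rmorph_nat ltrBlDr.
  apply: (@le_lt_trans _ _ (ratr (red_value x) / (3 * M)%:R)).
    by rewrite ler_wpM2r ?invr_ge0 // ler_rat.
  by rewrite ltrDl invr_gt0.
have := ae_foralln hk; have := @ae_is_play R G' x tau1 tau2.
apply: (@filterS2 _ _ (ae_filter_ringOfSetsType _)) => w pw hw; split=> //.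
under [X in limn_einf X]eq_fun do rewrite natr_sum_reward.
exact: limn_einf_ge.
Qed.

Lemma Positive1_objective lambda (x : G') :
  Positive1 G' (objective lambda) x -> lambda <= red_value x.
Proof.
move=> [tau1 h1]; have [tau2 h2] := ae_reward_le x.
rewrite leNgt; apply/negP => lx; have := h1 tau2.
have M3 : 0 < (3 * M)%:R :> R by rewrite ltr0n muln_gt0.
suff H : {ae Pr x tau1 tau2, forall w : seqs_mtype x, ~ objective lambda w}.
  have N : (Pr x tau1 tau2).-negligible (objective lambda).
    by apply: negligibleS H => w Ow /(_ Ow).
  by rewrite (measure_negligible _ N) ?ltxx //; exact: measurable_LimInfAvg.
have xl : ratr (red_value x) / (3 * M)%:R < ratr lambda / (3 * M)%:R :> R.
  by rewrite ltr_pM2r ?invr_gt0 // ltr_rat.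
(* A threshold strictly below the target: averages eventually at most [q] force the limit inferior
   below it. *)
pose q : R := (ratr (red_value x) / (3 * M)%:R + ratr lambda / (3 * M)%:R) / 2.
have /(h2 tau1) : ratr (red_value x) / (3 * M)%:R < q by rewrite /q; lra.
apply: (@filterS _ _ (ae_filter_ringOfSetsType _)) => w hw [_].
under [X in limn_einf X]eq_fun do rewrite natr_sum_reward.
rewrite fmorph_div /= rmorph_nat => /le_trans/(_ (limn_einf_le _ _ hw)).
by rewrite lee_fin /q; lra.
Qed.

(** The cycle of inclusions: Almost in Positive, Positive in the states of value at least [lambda],
    and these in Almost. *)
Lemma objective_value lambda :
  (forall x : G', lambda <= red_value x <-> Almost1 G' (objective lambda) x) /\
  Almost1 G' (objective lambda) = Positive1 G' (objective lambda).
Proof.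
have AP (x : G') : Almost1 G' (objective lambda) x -> Positive1 G' (objective lambda) x.
  by move=> [tau1 h]; exists tau1 => tau2; rewrite h lte01.
split=> [x|].
  by split=> [|/AP]; [exact: Almost1_objective|exact: Positive1_objective].
apply/seteqP; split=> [x|x /Positive1_objective]; [exact: AP|exact: Almost1_objective].
Qed.

End reduction.

Theorem theorem21 (R : realType) (M : nat) (M_gt0 : (0 < M)%N) (G : dmpg M)
    (M_max : exists s t : G, dedge G s t /\ dreward G s t = M)
    (s : G) (lambda : rat) :
  let G' := Red R G M_gt0 in
  let Phi : set (nat -> G') :=
    LimInfAvg G' (fun x y => nat_of_bool (red_reward G x y))
      (ratr (lambda / (3 * M)%N%:R)) in
  (lambda <= game_value s <-> Almost1 G' Phi (inl s : G')) /\
  Almost1 G' Phi = Positive1 G' Phi.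
Proof.
have [almost almost_positive] := @objective_value R M M_gt0 G lambda.
by split; [exact: (almost (inl s))|exact: almost_positive].
Qed.
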